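(* Let $H$ be a Hilbert space, $U\subset H$ a closed linear subspace, $W\subset H$ a closed affine subspace with direction subspace $V$, and $u^{(0)}\in U$. Let $(u^{(n)})_{n\ge0}$ be defined by $$u^{(n+1)}=P_UP_W^{\alpha_n}u^{(n)},\qquad n\ge0,$$ where $(\alpha_n)_{n\ge0}$ is a real sequence such that $\lambda_n:=\frac{\sin^2\theta_p}{2}\,\alpha_n$ satisfies $\lambda_n\in[0,1]$ for all $n\ge0$ and $\sum_{n\ge0}\lambda_n(1-\lambda_n)=\infty$. Then: (i) if $M_{U,W}\neq\emptyset$, $u^{(n)}$ converges in norm to $P_{M_{U,W}}u^{(0)}$; (ii) if $M_{U,W}=\emptyset$, $\|u^{(n)}\|$ tends to $\infty$.
   Context: $P_S$ denotes the orthogonal projection onto a nonempty closed affine subspace $S$ of $H$. For $\alpha\in\mathbb R$ and $u\in H$, $P_W^\alpha u:=u+\alpha(P_Wu-u)$. $M_{U,W}:=\{u\in U:\|u-P_Wu\|=\inf_{v\in U}\|v-P_Wv\|\}$. The angle $\theta_p=\theta_p(U,V)\in[0,\pi/2]$ is defined by $\theta_p:=\arcsin\|P_UP_{V^\perp}\|$ (operator norm). *)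

(* Defs.v *)
From HB Require Import structures.
From mathcomp Require Import all_boot all_order all_algebra.
From mathcomp Require Import all_classical all_reals all_analysis.
From mathcomp Require Import complex.

Set Implicit Arguments.
Unset Strict Implicit.
Unset Printing Implicit Defensive.

Import Order.TTheory GRing.Theory Num.Theory.
Import numFieldNormedType.Exports.

Local Open Scope classical_set_scope.
Local Open Scope ring_scope.

(* Hilbert spaces are real or complex.  Over 'R[i]' MathComp-Analysis norms
   take their values in 'R[i]' itself, hence the conversions below. *)
Inductive scalar_kind := RealScalars | ComplexScalars.

Definition scalars (R : realType) (k : scalar_kind) : numFieldType :=
  match k with
  | RealScalars => R : numFieldType
  | ComplexScalars => R[i] : numFieldType
  end.

Definition re_scalar (R : realType) (k : scalar_kind) : scalars R k -> R :=
  match k with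
  | RealScalars => fun z => z
  | ComplexScalars => fun z => complex.Re z
  end.

Definition of_real (R : realType) (k : scalar_kind) : R -> scalars R k :=
  match k with
  | RealScalars => fun r => r
  | ComplexScalars => fun r => r%:C%C
  end.

Definition conj_scalar (R : realType) (k : scalar_kind) :
    scalars R k -> scalars R k :=
  match k with
  | RealScalars => fun z => z
  | ComplexScalars => fun z => z^*%C
  end.

(* The inner product is linear in its first argument and conjugate-linear in
   the second. *)
HB.mixin Record isHilbert (R : realType) (k : scalar_kind) H
  of CompleteNormedModule (scalars R k) H := {
  inner : {dot H for @conj_scalar R k};
  norm_inner : forall x : H, `|x| ^+ 2 = inner x x }.

#[short(type="hilbertType")]
HB.structure Definition Hilbert (R : realType) (k : scalar_kind) :=
  {H of isHilbert R k H & CompleteNormedModule (scalars R k) H}.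

Section Definitions.
Context {R : realType} {k : scalar_kind} {H : hilbertType R k}.
Implicit Types (S U V W : set H) (x : H).

Definition rnorm x : R := re_scalar (`|x| : scalars R k).

(* For S a closed affine subspace, the point p of S such that x - p is orthogonal
   to the direction of S; an arbitrary vector if there is no such p. *)
Definition orth_proj S x : H :=
  get [set p | S p /\ forall q, S q -> inner (x - p) (q - p) = 0].

Definition relaxed_proj S (a : R) x : H :=
  x + @of_real R k a *: (orth_proj S x - x).

Definition orthocomplement S : set H :=
  [set x | forall v, S v -> inner x v = 0].

Definition linear_subspace V := submod_closed (mem V).

Definition affine_subspace_directed_by W V :=
  linear_subspace V /\ exists w, W = [set w + v | v in V].

Definition opnorm (f : H -> H) : R :=
  sup [set rnorm (f x) | x in [set x | rnorm x <= 1]].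

Definition theta_p U V : R :=
  asin (opnorm (orth_proj U \o orth_proj (orthocomplement V))).

Definition min_dist_set U W : set H :=
  [set u | U u /\
    rnorm (u - orth_proj W u) = inf [set rnorm (v - orth_proj W v) | v in U]].

End Definitions.

(* Main.v *)
Require Import Defs.
From mathcomp Require Import all_boot all_order all_algebra.
From mathcomp Require Import all_classical all_reals all_analysis.
From mathcomp Require Import complex ring lra.

Set Implicit Arguments.
Unset Strict Implicit.
Unset Printing Implicit Defensive.

Import Order.TTheory GRing.Theory Num.Theory.
Import numFieldNormedType.Exports.

Local Open Scope classical_set_scope.
Local Open Scope ring_scope.

(** Write [P] for the projection onto [U], [Q = 1 - P_V] for the projection onto
    the orthogonal complement of [V], [A = P Q P] and [b = P Q w] with [w] in
    [W].  For [u] in [U] the iteration is the Richardson scheme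
    [u' = u - alpha (A u - b)], and [M_{U,W}] is the set of solutions of
    [A u = b] in [U].  With [s = ||P Q|| = sin theta_p], one has
    [||A x||^2 <= s^2 <A x, x>], so every orbit of [v' = v - alpha A v] satisfies
    [||v'||^2 <= ||v||^2 - (4 / s^4) lambda (1 - lambda) ||A v||^2].  As [A v] is
    again an orbit, its norm decreases, hence tends to 0 because the series
    diverges; by density of the range of [A] in the orthogonal complement of its
    kernel, [v] tends to 0 as soon as its initial value is orthogonal to that
    kernel.  Part (i) applies this to [u - P_M u0] and part (ii) to the residual
    [A u - b]: a bounded subsequence of [u] would then consist of approximate
    solutions, and the points of almost minimal norm of the nested convex sets
    [||A x - b|| <= 1 / (n + 1)] converge to a solution. *)

(** * Real parts of real or complex scalars *)

Section Scalars.
Context {R : realType} {k : scalar_kind}.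
Implicit Types (r s : R) (z : scalars R k).

Lemma of_realD r s : @of_real R k (r + s) = of_real k r + of_real k s.
Proof. by case: k => //=; rewrite rmorphD. Qed.

Lemma ltr_of_real r s : (of_real k r < of_real k s) = (r < s).
Proof. by case: k => //=; rewrite ltcR. Qed.

Lemma re_scalar0 : re_scalar (0 : scalars R k) = 0.
Proof. by case: k. Qed.

Lemma re_scalarD z z' : re_scalar (z + z') = re_scalar z + re_scalar z'.
Proof. by case: k z z' => //= z z'; rewrite raddfD. Qed.

Lemma re_scalarN z : re_scalar (- z) = - re_scalar z.
Proof. by case: k z => //= z; rewrite raddfN. Qed.

Lemma re_scalarZ r z : re_scalar (of_real k r * z) = r * re_scalar z.
Proof. by case: k z => //= -[a b] /=; rewrite mul0r subr0. Qed.

Lemma re_conj_scalar z : re_scalar (conj_scalar z) = re_scalar z.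
Proof. by case: k z => //= -[]. Qed.

Lemma of_real_re z : 0 <= z -> z = of_real k (re_scalar z).
Proof. by case: k z => //= -[a b]; rewrite lecE /= => /andP[/eqP -> _]. Qed.

Lemma re_scalar_ge0 z : 0 <= z -> 0 <= re_scalar z.
Proof. by case: k z => //= -[a b]; rewrite lecE /= => /andP[_]. Qed.

Lemma of_real_gt0 r : 0 < r -> 0 < of_real k r.
Proof. by case: k => //=; rewrite ltcR. Qed.

Lemma re_scalar_gt0 z : 0 < z -> 0 < re_scalar z.
Proof. by case: k z => //= -[a b]; rewrite ltcE /= => /andP[]. Qed.

(** The real part here is the squared modulus of [z]; this later turns orthogonality for the real
    inner product into orthogonality over the scalars. *)
Lemma re_conj_mul_eq0 z : re_scalar (conj_scalar z * z) = 0 -> z = 0.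
Proof.
case: k z => /= [z /eqP|[a b] /= h]; first by rewrite mulf_eq0 orbb => /eqP.
have [-> ->//] : a = 0 /\ b = 0 by split; nra.
Qed.

End Scalars.

(** * The underlying real Hilbert space and its real-valued norm *)

Section RealStructure.
Context {R : realType} {k : scalar_kind} {H : hilbertType R k}.
Implicit Types (x y z : H) (r s : R).

(* The real and complex cases are treated uniformly by viewing [H] as a real
   Hilbert space. *)
Definition rinner x y : R := re_scalar (inner x y).
Definition rscale r x : H := of_real k r *: x.

Lemma innerBl x y z : inner (x - y) z = inner x z - inner y z.
Proof. exact: linearBl. Qed.

Lemma innerC x y : inner x y = conj_scalar (inner y x).
Proof. by rewrite hermitian_subproof expr0 mul1r. Qed.

Lemma rinnerC x y : rinner x y = rinner y x.
Proof.
by rewrite /rinner innerC re_conj_scalar.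
Qed.

Lemma rinnerDl x y z : rinner (x + y) z = rinner x z + rinner y z.
Proof. by rewrite /rinner linearDl re_scalarD. Qed.

Lemma rinner0l z : rinner 0 z = 0.
Proof. by rewrite /rinner linear0l re_scalar0. Qed.

Lemma rinnerNl x z : rinner (- x) z = - rinner x z.
Proof. by rewrite /rinner linearNl re_scalarN. Qed.

Lemma rinnerBl x y z : rinner (x - y) z = rinner x z - rinner y z.
Proof. by rewrite rinnerDl rinnerNl. Qed.

Lemma rinnerZl r x z : rinner (rscale r x) z = r * rinner x z.
Proof. by rewrite /rinner /rscale linearZl_LR re_scalarZ. Qed.

Lemma rinnerDr x y z : rinner x (y + z) = rinner x y + rinner x z.
Proof. by rewrite !(rinnerC x) rinnerDl. Qed.

Lemma rinnerNr x z : rinner x (- z) = - rinner x z.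
Proof. by rewrite !(rinnerC x) rinnerNl. Qed.

Lemma rinnerBr x y z : rinner x (y - z) = rinner x y - rinner x z.
Proof. by rewrite rinnerDr rinnerNr. Qed.

Lemma rinnerZr r x z : rinner x (rscale r z) = r * rinner x z.
Proof. by rewrite !(rinnerC x) rinnerZl. Qed.

Definition rinnerE :=
  (rinnerDl, rinnerDr, rinnerNl, rinnerNr, rinnerZl, rinnerZr).

Lemma norm_rnorm x : `|x| = of_real k (rnorm x).
Proof. exact: of_real_re. Qed.

Lemma rnorm_ge0 x : 0 <= rnorm x.
Proof. exact: re_scalar_ge0. Qed.

Lemma rnorm0 : rnorm (0 : H) = 0.
Proof. by rewrite /rnorm normr0; case: (k). Qed.

Lemma rnormN x : rnorm (- x) = rnorm x.
Proof. by rewrite /rnorm normrN. Qed.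

Lemma rnorm_sqr x : rnorm x ^+ 2 = rinner x x.
Proof.
rewrite /rinner -norm_inner norm_rnorm !expr2 re_scalarZ.
by congr (_ * _); rewrite -norm_rnorm.
Qed.

Lemma rinner_ge0 x : 0 <= rinner x x.
Proof. by rewrite -rnorm_sqr sqr_ge0. Qed.

Lemma rinner_eq0 x : rinner x x = 0 -> x = 0.
Proof.
rewrite -rnorm_sqr => /eqP; rewrite sqrf_eq0 => /eqP h.
apply/eqP; rewrite -normr_eq0 norm_rnorm h; apply/eqP.
by case: (k).
Qed.

Lemma rnorm_eq0 x : rnorm x = 0 -> x = 0.
Proof. by move=> h; apply: rinner_eq0; rewrite -rnorm_sqr h expr0n. Qed.

Lemma rnormD x y : rnorm (x + y) <= rnorm x + rnorm y.
Proof.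
rewrite leNgt -(@ltr_of_real _ k) of_realD -!norm_rnorm; apply/negP => h.
by have := lt_le_trans h (ler_normD x y); rewrite ltxx.
Qed.

Lemma rnorm_distD y x z : rnorm (x - z) <= rnorm (x - y) + rnorm (y - z).
Proof. by rewrite -[x - z](subrKA y) rnormD. Qed.

(* Reduces linear identities between vectors to [ring] identities in [R]. *)
Lemma rinner_inj x y : (forall z, rinner x z = rinner y z) -> x = y.
Proof.
move=> h; apply/eqP; rewrite -subr_eq0; apply/eqP/rinner_eq0.
by rewrite rinnerBl h subrr.
Qed.

Lemma closed_rnorm (S : set H) x : closed S ->
  (forall e : R, 0 < e -> exists2 y, S y & rnorm (x - y) < e) -> S x.
Proof.
move=> /closure_id cS h; rewrite cS => A /nbhs_ballP[e /= e0 eA].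
have e0' := re_scalar_gt0 e0.
have [y Sy xy] := h _ e0'; exists y; split=> //; apply: eA.
by rewrite -ball_normE /ball_/= norm_rnorm (of_real_re (ltW e0)) ltr_of_real.
Qed.

Lemma cvg_rnorm (u : nat -> H) x :
  (forall e : R, 0 < e -> \forall n \near \oo, rnorm (x - u n) < e) ->
  u n @[n --> \oo] --> x.
Proof.
move=> h; apply/cvgrPdist_lt => e e0.
have e0' := re_scalar_gt0 e0.
apply: filterS (h _ e0') => n /= xn.
by rewrite norm_rnorm (of_real_re (ltW e0)) ltr_of_real.
Qed.

Lemma rnorm_cauchy (u : nat -> H) :
  (forall e : R, 0 < e -> exists N, forall m n, (N <= m)%N -> (N <= n)%N ->
    rnorm (u m - u n) < e) ->
  exists x, forall e : R, 0 < e -> \forall n \near \oo, rnorm (x - u n) < e.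
Proof.
move=> h.
have cu : cvgn u.
  apply/cauchy_cvgP/cauchy_ballP => e e0.
  have e0' := re_scalar_gt0 e0.
  have [N hN] := h _ e0'.
  pose T := [set u n | n in [set n | (N <= n)%N]]; exists (T, T).
    by split; exists N => //= n Nn; exists n.
  move=> [_ _] /= [[m Nm <-] [n Nn <-]].
  rewrite -ball_normE /ball_/= norm_rnorm (of_real_re (ltW e0)) ltr_of_real.
  exact: hN.
exists (limn u) => e e0.
have /cvgrPdist_lt/(_ (of_real k e)) : u @ \oo --> limn u by [].
move=> /(_ (of_real_gt0 e0)); apply: filterS => n.
by rewrite norm_rnorm ltr_of_real.
Qed.

End RealStructure.

(** * Points of least norm and orthogonal projections *)

Section Projections.
Context {R : realType} {k : scalar_kind} {H : hilbertType R k}.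
Implicit Types (x y z : H) (r s : R) (S : set H).

(** Closedness with real radii, since the balls of [H] have radii in [scalars R k]. *)
Definition rclosed S := forall x,
  (forall e : R, 0 < e -> exists2 y, S y & rnorm (x - y) < e) -> S x.

(** Real scalars only: the notion must cover the closure of the range of [A], whose linearity is
    derived over the reals. *)
Definition rsubspace S := [/\ S 0, forall x y, S x -> S y -> S (x + y) &
  forall r x, S x -> S (rscale r x)].

Lemma midpointE x y :
  rinner (x - y) (x - y) = 2 * rinner x x + 2 * rinner y y -
    4 * rinner (rscale 2^-1 (x + y)) (rscale 2^-1 (x + y)).
Proof. by rewrite !rinnerE (rinnerC y x); field. Qed.

(* By the parallelogram identity, approximate minimizers of the norm on a
   decreasing sequence of convex sets form a Cauchy sequence as soon as the
   infima of the norms are bounded. *)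
Lemma nested_min_norm (C : nat -> set H) r :
  (forall n, rclosed (C n)) ->
  (forall n x y, C n x -> C n y -> C n (rscale 2^-1 (x + y))) ->
  (forall m n, (m <= n)%N -> C n `<=` C m) ->
  (forall n, exists2 x, C n x & rnorm x <= r) ->
  exists2 x, (forall n, C n x) &
    forall y, (forall n, C n y) -> rnorm x <= rnorm y.
Proof.
move=> clC midC decC bndC.
pose N2 n := [set rinner x x | x in C n].
pose d n := inf (N2 n).
have lbN n : lbound (N2 n) 0 by move=> _ [x _ <-]; exact: rinner_ge0.
have neN n : N2 n !=set0 by have [x Cx _] := bndC n; exists (rinner x x), x.
have d_le n x : C n x -> d n <= rinner x x.
  by move=> Cx; apply: ge_inf; [exists 0; exact: lbN|exists x].
have d_le_r n : d n <= r ^+ 2.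
  have [x /d_le dx xr] := bndC n; apply: le_trans dx _; rewrite -rnorm_sqr.
  by rewrite ler_sqr ?nnegrE ?rnorm_ge0// (le_trans (rnorm_ge0 x)).
pose D := sup (range d).
have supD : has_sup (range d).
  by split; [exists (d 0%N), 0%N|exists (r ^+ 2) => _ [n _ <-]].
have d_le_D n : d n <= D by apply: sup_upper_bound => //; exists n.
have /choice[x xP] n : exists x, C n x /\ rinner x x < D + n.+1%:R^-1.
  have dD : d n < D + n.+1%:R^-1.
    by rewrite (le_lt_trans (d_le_D n))// ltrDl invr_gt0.
  by have [_ [x Cx <-] xD] := inf_lt (neN n) dD; exists x.
have inv_le m n : (m <= n)%N -> n.+1%:R^-1 <= m.+1%:R^-1 :> R.
  by move=> mn; rewrite lef_pV2 ?posrE// ler_nat.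
(* In [midpointE], the excesses of both squared norms over [D] and the deficit of the midpoint's are
   each below [e ^+ 2 / 8]; with weights 2, 2 and 4 they add up to less than [e ^+ 2]. *)
have lim_est (a b c f D' e2 i j l : R) : a < D' + i -> b < D' + j ->
    D' - e2 / 8 < f -> l < e2 / 8 -> j <= l -> i <= l -> f <= c ->
    2 * a + 2 * b - 4 * c < e2 by lra.
have [|l lP] := @rnorm_cauchy _ _ _ x.
  move=> e e0.
  have e8 : 0 < e ^+ 2 / 8 by rewrite divr_gt0// exprn_gt0.
  have [_ [N1 _ <-] dN1] := sup_adherent e8 supD.
  have [N2' hN2] := ltr_add_invr e8; rewrite add0r in hN2.
  exists (maxn N1 N2') => m n; rewrite !geq_max => /andP[m1 m2] /andP[n1 n2].
  have [Cm xm] := xP m; have [Cn xn] := xP n.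
  have /d_le := midC _ _ _ (decC _ _ m1 _ Cm) (decC _ _ n1 _ Cn).
  have := midpointE (x m) (x n).
  have := inv_le _ _ m2; have := inv_le _ _ n2.
  rewrite -/D in dN1; move: dN1 hN2 xm xn => dN1 hN2 xm xn im i_n mid dmid.
  rewrite -ltr_sqr ?nnegrE ?rnorm_ge0 ?ltW// rnorm_sqr.
  rewrite mid; exact: (lim_est _ _ _ _ _ _ _ _ _ xm xn dN1 hN2 im i_n dmid).
have lim_tail e N : 0 < e -> exists n, (N <= n)%N /\ rnorm (l - x n) < e.
  by move=> /lP[M _ hM]; exists (maxn M N); rewrite leq_maxr; split=> //;
    apply: hM; rewrite /= leq_maxl.
exists l => [n|y Cy].
  apply: clC => e /(lim_tail _ n)[m [nm lm]]; exists (x m) => //.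
  exact: decC nm _ (xP m).1.
rewrite leNgt; apply/negP => yl.
have D_le : D <= rinner y y.
  by apply: ge_sup; [exists (d 0%N), 0%N|move=> _ [n _ <-]; exact: d_le].
(* With [g] this half gap, some late [x n] has norm at least [rnorm y + g], yet squared norm below
   [rnorm y ^+ 2 + g ^+ 2], which is absurd. *)
have e0 : 0 < (rnorm l - rnorm y) / 2 by lra.
have [N hN] := ltr_add_invr (exprn_gt0 2 e0); rewrite add0r in hN.
have [n [Nn ln]] := lim_tail _ N e0.
have norm_est (a b D' e i j : R) : 0 <= b -> 0 < e -> b + e <= a ->
    a ^+ 2 < D' + i -> D' <= b ^+ 2 -> i <= j -> j < e ^+ 2 -> False by nra.
have yxn : rnorm y + (rnorm l - rnorm y) / 2 <= rnorm (x n).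
  by have := rnormD (l - x n) (x n); rewrite subrK; lra.
have := (xP n).2; rewrite -rnorm_sqr => xn; rewrite -rnorm_sqr in D_le.
exact: (norm_est _ _ _ _ _ _ (rnorm_ge0 y) e0 yxn xn D_le (inv_le _ _ Nn) hN).
Qed.

Lemma rsubspaceB S x y : rsubspace S -> S x -> S y -> S (x - y).
Proof.
move=> [_ SD SZ] Sx Sy; apply: SD => //.
have -> : - y = rscale (-1) y by apply: rinner_inj => z; rewrite !rinnerE; ring.
exact: SZ.
Qed.

(** The element [y] of least norm in [x - S], from a constant sequence of sets, gives [p = x - y];
    perturbing [y] along [v] shows orthogonality. *)
Lemma rproj_exists S x : rsubspace S -> rclosed S ->
  exists2 p, S p & forall v, S v -> rinner (x - p) v = 0.
Proof.
move=> sS cS; have [S0 SD SZ] := sS.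
have [||||y Cy minY] := @nested_min_norm (fun=> [set y | S (x - y)]) (rnorm x).
- move=> _ y hy; apply: cS => e /hy[z Sz yz]; exists (x - z) => //.
  have -> : x - y - (x - z) = - (y - z) by rewrite opprB addrC subrKA opprB.
  by rewrite rnormN.
- move=> _ y z /= Sy Sz.
  have -> : x - rscale 2^-1 (y + z) = rscale 2^-1 ((x - y) + (x - z)).
    by apply: rinner_inj => w; rewrite !rinnerE; field.
  by apply: SZ; exact: SD.
- by move=> m n _ y.
- by exists x => //=; rewrite subrr.
exists (x - y) => [|v Sv]; first exact: (Cy 0%N).
rewrite opprB addrC subrK; set a := rinner y v; set n := rinner v v.
have n0 : 0 <= n by exact: rinner_ge0.
(* The denominator [n + 1] is positive even for [v = 0]; minimality against [y - t v] then reads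
   [t ^+ 2 * (n + 2) <= 0]. *)
set t := a / (n + 1).
have /(_ _)/= := minY (y - rscale t v).
have -> : x - (y - rscale t v) = x - y + rscale t v.
  by rewrite opprB addrA addrAC.
move=> /(_ (fun=> SD _ _ (Cy 0%N) (SZ _ _ Sv))).
rewrite -ler_sqr ?nnegrE ?rnorm_ge0// !rnorm_sqr !rinnerE (rinnerC v y) -/a -/n.
have ta : a = t * (n + 1) by rewrite /t divfK// gt_eqF// ltr_wpDl.
rewrite {}ta; clearbody t n; clear a => h.
have t0 : t ^+ 2 <= 0 by rewrite expr2; nra.
have : t ^+ 2 == 0 by rewrite eq_le t0 sqr_ge0.
by rewrite sqrf_eq0 => /eqP ->; rewrite mul0r.
Qed.

Lemma linear_subspace_rsubspace S : linear_subspace S -> rsubspace S.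
Proof.
move=> [S0 Slin]; rewrite !inE in S0.
have lin a x y : S x -> S y -> S (a *: x + y).
  by move=> Sx Sy; have := Slin a x y; rewrite !inE; exact.
split=> // [x y Sx Sy|r x Sx]; first by rewrite -[x]scale1r; exact: lin.
by rewrite -[rscale _ _]addr0; exact: lin.
Qed.

(** Testing against [inner x v *: v], which stays in [S], produces the squared modulus of
    [inner x v]. *)
Lemma linear_subspace_inner0 S x : linear_subspace S ->
  (forall v, S v -> rinner x v = 0) -> forall v, S v -> inner x v = 0.
Proof.
move=> [S0 Slin] h v Sv; rewrite !inE in S0.
have Siv : S (inner x v *: v).
  have := Slin (inner x v) v 0; rewrite !inE addr0; exact.
apply: re_conj_mul_eq0; rewrite -[RHS](h _ Siv) /rinner.
by rewrite linearZr_LR.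
Qed.

Lemma linear_subspaceI S T :
  linear_subspace S -> linear_subspace T -> linear_subspace (S `&` T).
Proof.
move=> [S0 Slin] [T0 Tlin]; rewrite !inE in S0 T0.
split=> [|a x y]; rewrite !inE // => -[Sx Tx] [Sy Ty]; split.
  by have := Slin a x y; rewrite !inE; exact.
by have := Tlin a x y; rewrite !inE; exact.
Qed.

(** Two candidates, each tested at the other, give conditions that add up to [|q - p|^2 = 0]. This
    evaluates the [get] in [orth_proj]. *)
Lemma orth_proj_unique S x p : S p ->
  (forall q, S q -> inner (x - p) (q - p) = 0) -> orth_proj S x = p.
Proof.
move=> Sp hp; rewrite /orth_proj; set P := [set _ | _].
have [Sq hq] : P (get P) by apply: (@getI _ P p); split.
set q := get P in Sq hq *; apply/eqP; rewrite -subr_eq0; apply/eqP/rinner_eq0.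
have := congr1 (@re_scalar R k) (hp _ Sq).
have := congr1 (@re_scalar R k) (hq _ Sp).
rewrite re_scalar0 -!/(rinner _ _) !rinnerE => h1 h2.
lra.
Qed.

End Projections.

(** * Real linearity of symmetric maps *)

Section SelfAdjoint.
Context {R : realType} {k : scalar_kind} {H : hilbertType R k}.
Variable A : H -> H.
Hypothesis A_adj : forall x y, rinner (A x) y = rinner x (A y).

Lemma selfadjD x y : A (x + y) = A x + A y.
Proof. by apply: rinner_inj => z; rewrite rinnerDl !A_adj rinnerDl. Qed.

Lemma selfadjZ r x : A (rscale r x) = rscale r (A x).
Proof. by apply: rinner_inj => z; rewrite rinnerZl !A_adj rinnerZl. Qed.

Lemma selfadjN x : A (- x) = - A x.
Proof. by apply: rinner_inj => z; rewrite rinnerNl !A_adj rinnerNl. Qed.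

Lemma selfadjB x y : A (x - y) = A x - A y.
Proof. by rewrite selfadjD selfadjN. Qed.

Lemma selfadj0 : A 0 = 0.
Proof. by rewrite -[X in A X](subrr (0 : H)) selfadjB subrr. Qed.

End SelfAdjoint.

(** * Orbits of the relaxation [v' = v - alpha A v] *)

Section Relaxation.
Context {R : realType} {k : scalar_kind} {H : hilbertType R k}.
Variables (A : H -> H) (s : R) (alpha : nat -> R).
Let lambda n := s ^+ 2 / 2 * alpha n.
Hypothesis A_adj : forall x y, rinner (A x) y = rinner x (A y).
Hypothesis A_le : forall x, rinner (A x) (A x) <= s ^+ 2 * rinner (A x) x.
Hypothesis s_gt0 : 0 < s.
Hypothesis lambda01 : forall n, 0 <= lambda n <= 1.
Hypothesis lambda_div : forall M : R, exists n,
  M < \sum_(0 <= i < n) lambda i * (1 - lambda i).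

Definition relaxation (v : nat -> H) :=
  forall n, v n.+1 = v n - rscale (alpha n) (A (v n)).

Lemma relaxation_image v : relaxation v -> relaxation (A \o v).
Proof. by move=> hv n /=; rewrite hv (selfadjB A_adj) (selfadjZ A_adj). Qed.

Lemma relaxationB v w :
  relaxation v -> relaxation w -> relaxation (fun n => v n - w n).
Proof.
move=> hv hw n; rewrite hv hw (selfadjB A_adj).
by apply: rinner_inj => z; rewrite !rinnerE; ring.
Qed.

Fixpoint relaxation_from (x : H) n : H :=
  if n is n'.+1 then relaxation_from x n' -
    rscale (alpha n') (A (relaxation_from x n')) else x.

(** Expand the square, put [alpha = 2 lambda / s^2], and bound the cross term by
    [<A v, v> >= |A v|^2 / s^2]. *)
Lemma relaxation_decrease v n : relaxation v ->
  rinner (v n.+1) (v n.+1) <= rinner (v n) (v n) -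
    4 / s ^+ 4 * (lambda n * (1 - lambda n)) * rinner (A (v n)) (A (v n)).
Proof.
move=> hv; rewrite hv.
have alphaE : alpha n = 2 / s ^+ 2 * lambda n.
  by rewrite /lambda; field; rewrite gt_eqF.
rewrite !rinnerE (rinnerC (v n)) alphaE.
have := A_le (v n); move: (rinner (A (v n)) (A (v n))) => a Aa.
have /andP[l0 _] := lambda01 n; move: (rinner (v n) (v n)) => b.
set c := rinner _ (v n) in Aa *.
(* [d] is the slack in [A_le]; the two sides of the goal then differ exactly by a nonnegative
   multiple of [lambda n * d]. *)
have {Aa} [d d0 ->] : exists2 d, 0 <= d & c = s ^- 2 * a + d.
  exists (c - s ^- 2 * a); last by rewrite addrC subrK.
  by rewrite subr_ge0 mulrC ler_pdivrMr ?exprn_gt0// mulrC.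
have -> : 4 / s ^+ 4 = 4 * s ^- 2 ^+ 2 :> R by rewrite exprVn -exprM.
have t0 : 0 <= s ^- 2 by rewrite invr_ge0 exprn_ge0// ltW.
move: (s ^- 2) t0 (lambda n) l0 => t t0 l l0.
have : 0 <= t * l * d by rewrite !mulr_ge0.
lra.
Qed.

Lemma relaxation_antitone v m n : relaxation v -> (m <= n)%N ->
  rinner (v n) (v n) <= rinner (v m) (v m).
Proof.
move=> hv; elim: n => [|n IH]; first by rewrite leqn0 => /eqP ->.
rewrite leq_eqVlt => /orP[/eqP -> //|/IH]; apply: le_trans.
apply: le_trans (relaxation_decrease n hv) _.
rewrite gerBl mulr_ge0 ?rinner_ge0// mulr_ge0//.
  by rewrite divr_ge0// exprn_ge0// ltW.
by have /andP[l0 l1] := lambda01 n; rewrite mulr_ge0// subr_ge0.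
Qed.

(** [A \o v] is an orbit too, so its norm decreases and one small value suffices. Were there none,
    the summed decreases of [|v|^2] would exceed its initial value. *)
Lemma relaxation_residual v e : relaxation v -> 0 < e ->
  exists N, forall n, (N <= n)%N -> rnorm (A (v n)) < e.
Proof.
move=> hv e0.
suff [N hN] : exists N, rinner (A (v N)) (A (v N)) < e ^+ 2.
  exists N => n Nn; rewrite -ltr_sqr ?nnegrE ?rnorm_ge0 ?ltW// rnorm_sqr.
  exact: le_lt_trans (relaxation_antitone (relaxation_image hv) Nn) hN.
apply/not_existsP => ge_e.
set c := 4 / s ^+ 4 * e ^+ 2.
have c0 : 0 < c by rewrite mulr_gt0 ?divr_gt0 ?exprn_gt0.
have [n] := lambda_div (rinner (v 0%N) (v 0%N) / c).
rewrite ltr_pdivrMr// => hn.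
suff : (\sum_(0 <= i < n) lambda i * (1 - lambda i)) * c + rinner (v n) (v n)
    <= rinner (v 0%N) (v 0%N).
  by have := rinner_ge0 (v n); lra.
elim: n {hn} => [|n IH]; first by rewrite big_nil mul0r add0r.
apply: le_trans IH; rewrite big_nat_recr//= mulrDl -addrA lerD2l.
have /andP[l0 l1] := lambda01 n.
have ll0 : 0 <= 4 / s ^+ 4 * (lambda n * (1 - lambda n)).
  by rewrite mulr_ge0// ?divr_ge0 ?exprn_ge0 ?(ltW s_gt0)// mulr_ge0 ?subr_ge0.
have := relaxation_decrease n hv; have /negP := ge_e n; rewrite -leNgt.
move=> /(ler_wpM2l ll0); rewrite /c.
by move: (4 / s ^+ 4) => q; lra.
Qed.

Lemma range_closure_subspace :
  rsubspace [set y | forall e : R, 0 < e -> exists z, rnorm (y - A z) < e].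
Proof.
split=> [e e0|x y hx hy e e0|r x hx e e0].
- by exists 0; rewrite (selfadj0 A_adj) subrr rnorm0.
- have e2 : 0 < e / 2 by rewrite divr_gt0.
  have [a ha] := hx _ e2; have [b hb] := hy _ e2; exists (a + b).
  rewrite (selfadjD A_adj) opprD addrACA; apply: le_lt_trans (rnormD _ _) _.
  by rewrite [ltRHS]splitr ltrD.
(* [1 + r ^+ 2] dominates [|r|] and is positive even for [r = 0]. *)
- have r0 : 0 < 1 + r ^+ 2 by rewrite ltr_pwDl// sqr_ge0.
  have [a ha] := hx (e / (1 + r ^+ 2)) (divr_gt0 e0 r0).
  exists (rscale r a); rewrite (selfadjZ A_adj).
  have -> : rscale r x - rscale r (A a) = rscale r (x - A a).
    by apply: rinner_inj => z; rewrite !rinnerE; ring.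
  rewrite ltr_pdivlMr// in ha; apply: le_lt_trans ha.
  rewrite -ler_sqr ?nnegrE ?mulr_ge0 ?rnorm_ge0 ?(ltW r0)//.
  rewrite exprMn !rnorm_sqr rinnerZl rinnerZr.
  rewrite mulrA -expr2 mulrC.
  rewrite ler_wpM2l ?rinner_ge0//.
  by move: (r ^+ 2) (sqr_ge0 r) => q q0; nra.
Qed.

(** Let [p] be the projection of [x] onto the closed range. Then [x - p] is orthogonal to the range,
    hence in the kernel, hence orthogonal to both [x] and [p]. *)
Lemma range_closure x : (forall y, A y = 0 -> rinner x y = 0) ->
  forall e : R, 0 < e -> exists z, rnorm (x - A z) < e.
Proof.
move=> x_ker.
set K := [set y | forall e : R, 0 < e -> exists z, rnorm (y - A z) < e].
have cK : rclosed K.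
  move=> y hy e e0; have e2 : 0 < e / 2 by rewrite divr_gt0.
  have [y' hy' yy'] := hy _ e2; have [z hz] := hy' _ e2; exists z.
  by apply: le_lt_trans (rnorm_distD y' _ _) _; rewrite [ltRHS]splitr ltrD.
have KA z : K (A z) by move=> e e0; exists z; rewrite subrr rnorm0.
have [p Kp hp] := rproj_exists x range_closure_subspace cK.
have Axp : A (x - p) = 0.
  by apply: rinner_eq0; rewrite A_adj hp//; exact: KA.
suff -> : x = p by exact: Kp.
apply/eqP; rewrite -subr_eq0; apply/eqP/rinner_eq0.
by rewrite {1}rinnerBl x_ker// rinnerC hp// subrr.
Qed.

(** Approximate [v 0] by [A z] and compare [v] with [A w], where [w] is the orbit of [z]: the
    difference is an orbit, so it stays below [e / 2], and [A w] tends to 0. *)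
Lemma relaxation_cvg0 v e : relaxation v ->
  (forall y, A y = 0 -> rinner (v 0%N) y = 0) -> 0 < e ->
  exists N, forall n, (N <= n)%N -> rnorm (v n) < e.
Proof.
move=> hv v_ker e0; have e2 : 0 < e / 2 by rewrite divr_gt0.
have [z hz] := range_closure v_ker e2.
have hw : relaxation (relaxation_from z) by [].
have [N hN] := relaxation_residual hw e2.
exists N => n Nn; set w := relaxation_from z in hw hN.
have := rnorm_distD (A (w n)) (v n) 0; rewrite !subr0 => /le_lt_trans; apply.
have : rnorm (v n - A (w n)) < e / 2.
  apply: le_lt_trans hz; rewrite -ler_sqr ?nnegrE ?rnorm_ge0// !rnorm_sqr.
  exact: (relaxation_antitone (relaxationB hv (relaxation_image hw)) (leq0n n)).
by have := hN _ Nn; lra.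
Qed.

End Relaxation.

(** * Projections onto closed subspaces, their complements and translates *)

Section OrthProj.
Context {R : realType} {k : scalar_kind} {H : hilbertType R k}.
Implicit Types (x y z : H) (r s : R) (S U V W : set H).

Lemma rnormZ r x : 0 <= r -> rnorm (rscale r x) = r * rnorm x.
Proof.
move=> r0; apply/eqP; rewrite -(@eqrXn2 _ 2) ?mulr_ge0 ?rnorm_ge0//.
by rewrite exprMn !rnorm_sqr rinnerZl rinnerZr mulrA.
Qed.

Lemma closed_rclosed S : closed S -> rclosed S.
Proof. by move=> cS x; exact: closed_rnorm. Qed.

Section LinearSubspace.
Variable S : set H.
Hypotheses (S_lin : linear_subspace S) (S_closed : rclosed S).
Local Notation P := (orth_proj S).

Lemma orth_projP x : S (P x) /\ forall v, S v -> inner (x - P x) v = 0.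
Proof.
have [p Sp hp] := rproj_exists x (linear_subspace_rsubspace S_lin) S_closed.
have ip := linear_subspace_inner0 S_lin hp.
rewrite (@orth_proj_unique _ _ _ S x p)// => q Sq; apply: ip.
exact: rsubspaceB (linear_subspace_rsubspace S_lin) Sq Sp.
Qed.

Lemma orth_proj_in x : S (P x).
Proof. by have [] := orth_projP x. Qed.

Lemma orth_proj_rinner0 x v : S v -> rinner (x - P x) v = 0.
Proof. by move=> Sv; rewrite /rinner (orth_projP x).2// re_scalar0. Qed.

Lemma orth_proj_rinner x v : S v -> rinner (P x) v = rinner x v.
Proof.
by move=> Sv; apply/eqP; rewrite eq_sym -subr_eq0 -rinnerBl orth_proj_rinner0.
Qed.

Lemma orth_proj_adj x y : rinner (P x) y = rinner x (P y).
Proof.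
by rewrite -(orth_proj_rinner x (orth_proj_in y)) !(rinnerC (P x))
  orth_proj_rinner//; exact: orth_proj_in.
Qed.

Lemma orth_proj_id x : S x -> P x = x.
Proof.
move=> Sx; apply/esym/eqP; rewrite -subr_eq0; apply/eqP/rinner_eq0.
apply: orth_proj_rinner0.
exact: rsubspaceB (linear_subspace_rsubspace S_lin) Sx (orth_proj_in x).
Qed.

Lemma orth_proj_pythagoras x :
  rinner x x = rinner (P x) (P x) + rinner (x - P x) (x - P x).
Proof.
have := orth_proj_rinner0 x (orth_proj_in x).
by rewrite !rinnerE (rinnerC (P x) x); lra.
Qed.

Lemma orth_proj_orthocomplement x :
  orth_proj (orthocomplement S) x = x - P x.
Proof.
apply: orth_proj_unique => [v Sv|q Sq]; first exact: (orth_projP x).2.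
rewrite {1}opprB (addrC x) subrK innerC innerBl.
rewrite (Sq _ (orth_proj_in x)) ((orth_projP x).2 _ (orth_proj_in x)) subrr.
by rewrite /conj_scalar; case: (k) => //; rewrite rmorph0.
Qed.

Lemma orth_proj_affine w x :
  orth_proj [set w + v | v in S] x = w + P (x - w).
Proof.
apply: orth_proj_unique; first by exists (P (x - w)) => //; exact: orth_proj_in.
move=> _ [v Sv <-]; rewrite opprD addrACA subrr add0r addrA.
apply: (orth_projP (x - w)).2.
by apply: rsubspaceB (linear_subspace_rsubspace S_lin) Sv (orth_proj_in _).
Qed.

End LinearSubspace.

Lemma rclosed_direction V w : rclosed [set w + v | v in V] -> rclosed V.
Proof.
move=> cW x hx; have [|v Vv /addrI <- //] := cW (w + x).
move=> e /hx[v Vv xv]; exists (w + v); first by exists v.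
by rewrite opprD addrACA subrr add0r.
Qed.

(** * The norm of [P Q] and the operator [A = P Q P] *)

Section TwoSubspaces.
Variables U V : set H.
Hypotheses (U_lin : linear_subspace U) (U_closed : rclosed U).
Hypotheses (V_lin : linear_subspace V) (V_closed : rclosed V).
Local Notation PU := (orth_proj U).
Local Notation Q := (orth_proj (orthocomplement V)).
Let s := opnorm (PU \o Q).

Lemma coproj_adj x y : rinner (Q x) y = rinner x (Q y).
Proof.
by rewrite !orth_proj_orthocomplement// rinnerBl rinnerBr orth_proj_adj.
Qed.

Lemma coproj_idem x : Q (Q x) = Q x.
Proof.
rewrite orth_proj_orthocomplement// orth_proj_orthocomplement//.
rewrite (selfadjB (orth_proj_adj V_lin V_closed)).
by rewrite (orth_proj_id V_lin V_closed (orth_proj_in _ _ _))// subrr subr0.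
Qed.

Lemma coproj_rinner x y : rinner (Q x) (Q y) = rinner (Q x) y.
Proof. by rewrite -coproj_adj coproj_idem. Qed.

Lemma coproj_eq0 x : Q x = 0 <-> V x.
Proof.
rewrite orth_proj_orthocomplement//; split=> [/eqP|Vx].
  by rewrite subr_eq0 => /eqP ->; exact: orth_proj_in.
by rewrite orth_proj_id// subrr.
Qed.

(** Pythagoras for each projection. This bound makes the supremum in [opnorm] finite and at most
    1. *)
Lemma comp_proj_le x : rnorm (PU (Q x)) <= rnorm x.
Proof.
rewrite -ler_sqr ?nnegrE ?rnorm_ge0// !rnorm_sqr.
have := orth_proj_pythagoras U_lin U_closed (Q x).
have := orth_proj_pythagoras V_lin V_closed x.
rewrite -orth_proj_orthocomplement//.
have := rinner_ge0 (orth_proj V x); have := rinner_ge0 (Q x - PU (Q x)).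
lra.
Qed.

Let has_sup_opnorm :
  has_sup [set rnorm ((PU \o Q) x) | x in [set x | rnorm x <= 1]].
Proof.
split; first by exists (rnorm (PU (Q 0))), 0 => //=; rewrite rnorm0.
by exists 1 => _ [x /= x1 <-]; apply: le_trans (comp_proj_le x) x1.
Qed.

Lemma opnorm_ge0 : 0 <= s.
Proof.
apply: le_trans (rnorm_ge0 (PU (Q 0))) _; apply: sup_upper_bound => //.
by exists 0 => //=; rewrite rnorm0.
Qed.

Lemma opnorm_le1 : s <= 1.
Proof.
apply: ge_sup; first by case: has_sup_opnorm.
by move=> _ [x /= x1 <-]; apply: le_trans (comp_proj_le x) x1.
Qed.

Lemma opnorm_le x : rnorm (PU (Q x)) <= s * rnorm x.
Proof.
have [x0|x0] := eqVneq (rnorm x) 0.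
  by rewrite x0 mulr0 -x0; exact: comp_proj_le.
have xp : 0 < rnorm x by rewrite lt_def x0 rnorm_ge0.
have : rnorm (PU (Q (rscale (rnorm x)^-1 x))) <= s.
  apply: sup_upper_bound => //; exists (rscale (rnorm x)^-1 x) => //=.
  by rewrite rnormZ ?invr_ge0 ?rnorm_ge0// mulVf.
rewrite (selfadjZ coproj_adj) (selfadjZ (orth_proj_adj U_lin U_closed)).
by rewrite rnormZ ?invr_ge0 ?rnorm_ge0// mulrC ler_pdivrMr.
Qed.

(** [asin] is inverted by [sin] because [s] lies in [[0, 1]]. *)
Lemma sin_theta_p : sin (theta_p U V) = s.
Proof.
apply: asinK; rewrite in_itv/= opnorm_le1 andbT.
by rewrite (le_trans _ opnorm_ge0)// lerN10.
Qed.

Let A x := PU (Q (PU x)).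

Lemma proj_coproj_adj x y : rinner (A x) y = rinner x (A y).
Proof. by rewrite /A orth_proj_adj// coproj_adj orth_proj_adj. Qed.

Lemma proj_coproj_rinner x : rinner (A x) x = rinner (Q (PU x)) (Q (PU x)).
Proof. by rewrite /A orth_proj_adj// coproj_rinner. Qed.

(** As [Q] is idempotent, [A x] is [P Q] applied to [Q P x], and [|Q P x|^2 = <A x, x>]. *)
Lemma proj_coproj_le x : rinner (A x) (A x) <= s ^+ 2 * rinner (A x) x.
Proof.
rewrite proj_coproj_rinner {1 2}/A -!rnorm_sqr -exprMn.
rewrite ler_sqr ?nnegrE ?mulr_ge0 ?rnorm_ge0 ?opnorm_ge0//.
by rewrite -{1}coproj_idem; exact: opnorm_le.
Qed.

Lemma proj_coproj_ker x : A x = 0 -> Q (PU x) = 0.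
Proof.
by move=> Ax; apply: rinner_eq0; rewrite -proj_coproj_rinner Ax rinner0l.
Qed.

Lemma proj_coproj_rnorm x : rnorm (A x) <= rnorm x.
Proof.
apply: le_trans (comp_proj_le _) _.
rewrite -ler_sqr ?nnegrE ?rnorm_ge0// !rnorm_sqr.
rewrite (orth_proj_pythagoras U_lin U_closed x).
by rewrite lerDl rinner_ge0.
Qed.

(** * The set [M] as the solutions of a normal equation *)

Section MinDist.
Variable w : H.
Local Notation W := [set w + v | v in V].
Local Notation M := (min_dist_set U W).

Lemma affine_residual x : x - orth_proj W x = Q (x - w).
Proof.
by rewrite orth_proj_affine// orth_proj_orthocomplement// opprD addrA.
Qed.

Lemma min_dist_setP u : M u <-> U u /\ PU (Q u) = PU (Q w).
Proof.
have adj := orth_proj_adj U_lin U_closed.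
have hinf v : U v ->
    inf [set rnorm (v - orth_proj W v) | v in U] <= rnorm (Q (v - w)).
  move=> Uv; rewrite -affine_residual; apply: ge_inf; last by exists v.
  by exists 0 => _ [? _ <-]; exact: rnorm_ge0.
rewrite /min_dist_set/=; split=> -[Uu].
  rewrite affine_residual => hu; split=> //; apply/eqP; rewrite -subr_eq0.
  rewrite -(selfadjB adj) -(selfadjB coproj_adj); apply/eqP/rinner_eq0.
  (* [d = P Q (u - w)] is the gradient in [U] of half the squared distance. The step to [u - d]
     lowers that squared distance by at least [|d|^2], so minimality forces [d = 0]. *)
  set d := PU _; have Ud : U d by exact: orth_proj_in.
  have := hinf (u - d) (rsubspaceB (linear_subspace_rsubspace U_lin) Uu Ud).
  rewrite -hu -ler_sqr ?nnegrE ?rnorm_ge0// !rnorm_sqr addrAC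
    (selfadjB coproj_adj _ d).
  have dd : rinner (Q (u - w)) (Q d) = rinner d d.
    by rewrite coproj_rinner -(orth_proj_rinner U_lin U_closed).
  have : rinner (Q d) (Q d) <= rinner d d.
    rewrite (orth_proj_pythagoras V_lin V_closed d).
    by rewrite -orth_proj_orthocomplement// lerDr rinner_ge0.
  have := rinner_ge0 d.
  rewrite !rinnerE (rinnerC (Q d) (Q (u - w))) dd => d0 dQ h.
  by apply/eqP; rewrite eq_le d0 andbT; lra.
move=> AE; split=> //; rewrite affine_residual; apply/eqP.
rewrite eq_le hinf// andbT; apply: lb_le_inf.
  by exists (rnorm (u - orth_proj W u)), u.
move=> _ [v Uv <-]; rewrite affine_residual.
have -> : v - w = (u - w) + (v - u) by rewrite [RHS]addrC subrKA.
rewrite (selfadjD coproj_adj (u - w)) -ler_sqr ?nnegrE ?rnorm_ge0// !rnorm_sqr.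
(* By the normal equation [Q (u - w)] is orthogonal to [U]; Pythagoras then makes [u] optimal. *)
have uv0 : rinner (Q (u - w)) (Q (v - u)) = 0.
  rewrite coproj_rinner -(orth_proj_rinner U_lin U_closed).
    by rewrite (selfadjB coproj_adj) (selfadjB adj) AE subrr rinner0l.
  exact: rsubspaceB (linear_subspace_rsubspace U_lin) Uv Uu.
rewrite rinnerDl !rinnerDr (rinnerC (Q (v - u))) uv0.
by have := rinner_ge0 (Q (v - u)); lra.
Qed.

End MinDist.

End TwoSubspaces.

End OrthProj.

Lemma pinfty_series_unbounded (R : realType) (a : nat -> R) :
  (forall n, 0 <= a n) -> (\sum_(0 <= n <oo) (a n)%:E = +oo)%E ->
  forall M : R, exists n, M < \sum_(0 <= i < n) a i.
Proof.
move=> a0 ainf M; apply/not_existsP => leM.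
have : (\sum_(0 <= n <oo) (a n)%:E <= M%:E)%E.
  apply: lime_le; first by apply: is_cvg_nneseries => n _ _; rewrite lee_fin.
  apply: nearW => n; rewrite sumEFin lee_fin leNgt; exact/negP/leM.
by rewrite ainf.
Qed.

(** * Solving [A x = b] from bounded approximate solutions *)

Section Solvability.
Context {R : realType} {k : scalar_kind} {H : hilbertType R k}.
Variables (U : set H) (A : H -> H) (b : H).
Hypotheses (U_sub : rsubspace U) (U_closed : rclosed U).
Hypothesis A_adj : forall x y, rinner (A x) y = rinner x (A y).
Hypothesis A_rnorm : forall x, rnorm (A x) <= rnorm x.

(** The sets [C n] are nested, convex, closed by continuity of [A], and all meet the ball of radius
    [r], so [nested_min_norm] gives a common point, whose residual is 0. *)
Lemma bounded_approx_solution r :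
  (forall e : R, 0 < e ->
    exists2 x, U x /\ rnorm (A x - b) <= e & rnorm x <= r) ->
  exists2 x, U x & A x = b.
Proof.
have [U0 UD UZ] := U_sub => approx.
pose C n := [set x | U x /\ rnorm (A x - b) <= n.+1%:R^-1].
have [||||x Cx _] := @nested_min_norm _ _ _ C r.
- move=> n x hx; split.
    by apply: U_closed => e /hx[y [Uy _] xy]; exists y.
  apply/ler_addgt0Pr => e /hx[y [_ yb] xy].
  apply: le_trans (rnorm_distD (A y) _ _) _; rewrite addrC lerD//.
  by rewrite -(selfadjB A_adj); apply: le_trans (A_rnorm _) (ltW xy).
- move=> n x y [Ux xb] [Uy yb]; split; first by apply: UZ; exact: UD.
  have -> : A (rscale 2^-1 (x + y)) - b =
      rscale 2^-1 ((A x - b) + (A y - b)).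
    rewrite (selfadjZ A_adj) (selfadjD A_adj).
    by apply: rinner_inj => z; rewrite !rinnerE; field.
  rewrite rnormZ ?invr_ge0// mulrC ler_pdivrMr//.
  by apply: le_trans (rnormD _ _) _; rewrite mulr_natr mulr2n lerD.
- move=> m n mn x [Ux xb]; split=> //; apply: le_trans xb _.
  by rewrite lef_pV2 ?posrE// ler_nat.
- by move=> n; apply: approx; rewrite invr_gt0.
exists x; first exact: (Cx 0%N).1.
apply/eqP; rewrite -subr_eq0; apply/eqP/rnorm_eq0/eqP.
rewrite eq_le rnorm_ge0 andbT; apply/ler_addgt0Pr => e e0; rewrite add0r.
have [N hN] := ltr_add_invr e0; rewrite add0r in hN.
exact: le_trans (Cx N).2 (ltW hN).
Qed.

End Solvability.

(** * Norm convergence or divergence of the relaxed projections *)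

Theorem proposition5p1 (R : realType) (k : scalar_kind) (H : hilbertType R k)
  (U V W : set H) (u : nat -> H) (alpha : nat -> R) :
  linear_subspace U -> closed U ->
  affine_subspace_directed_by W V -> closed W ->
  U (u 0%N) ->
  (forall n, u n.+1 = orth_proj U (relaxed_proj W (alpha n) (u n))) ->
  let lambda n := sin (theta_p U V) ^+ 2 / 2 * alpha n in
  (forall n, 0 <= lambda n <= 1) ->
  (\sum_(0 <= n <oo) (lambda n * (1 - lambda n))%:E = +oo)%E ->
  (min_dist_set U W !=set0 ->
     u n @[n --> \oo] --> orth_proj (min_dist_set U W) (u 0%N)) /\
  (min_dist_set U W = set0 -> rnorm (u n) @[n --> \oo] --> +oo).
Proof.
move=> U_lin U_cl [V_lin [w W_eq]] W_cl U_u0 u_rec lambda lambda01 lambda_div.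
subst W; set W := [set w + v | v in V] in W_cl u_rec *.
have U_closed := closed_rclosed U_cl.
have V_closed : rclosed V by exact: rclosed_direction (closed_rclosed W_cl).
have U_sub := linear_subspace_rsubspace U_lin.
pose PU := orth_proj U; pose Q := orth_proj (orthocomplement V).
pose s := opnorm (PU \o Q); pose A x := PU (Q (PU x)); pose b := PU (Q w).
have PU_adj : forall x y, rinner (PU x) y = rinner x (PU y).
  exact: orth_proj_adj.
have Q_adj : forall x y, rinner (Q x) y = rinner x (Q y) by exact: coproj_adj.
have A_adj : forall x y, rinner (A x) y = rinner x (A y).
  exact: proj_coproj_adj.
have A_le x : rinner (A x) (A x) <= s ^+ 2 * rinner (A x) x.
  exact: proj_coproj_le.
have lambdaE n : lambda n = s ^+ 2 / 2 * alpha n.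
  by rewrite /lambda sin_theta_p.
have div := pinfty_series_unbounded _ lambda_div.
have {lambda_div} div M : exists n,
    M < \sum_(0 <= i < n) s ^+ 2 / 2 * alpha i * (1 - s ^+ 2 / 2 * alpha i).
  have [|n hn] := div _ M.
    by move=> n; have /andP[l0 l1] := lambda01 n; rewrite mulr_ge0 ?subr_ge0.
  by exists n; under eq_bigr do rewrite -lambdaE.
(* If [s = 0], every [lambda n] vanishes and the series cannot diverge. *)
have s_gt0 : 0 < s.
  rewrite lt_def opnorm_ge0// andbT; apply/eqP => s0.
  have [n] := div 0; rewrite big1 ?ltxx// => i _.
  by rewrite s0 expr0n/= !mul0r.
have {}lambda01 n : 0 <= s ^+ 2 / 2 * alpha n <= 1 by rewrite -lambdaE.
have U_u n : U (u n) by case: n => // n; rewrite u_rec; exact: orth_proj_in.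
have PU_id x : U x -> PU x = x by exact: orth_proj_id.
have AU x : U x -> A x = PU (Q x) by move=> Ux; rewrite /A (PU_id x).
have {}u_rec n : u n.+1 = u n - rscale (alpha n) (A (u n) - b).
  rewrite u_rec /relaxed_proj -/(rscale _ _) -/PU -opprB affine_residual// -/Q.
  rewrite (selfadjD PU_adj) (selfadjZ PU_adj) (selfadjN PU_adj).
  rewrite (selfadjB Q_adj) (selfadjB PU_adj) (PU_id (u n))// AU//.
  by apply: rinner_inj => z; rewrite !rinnerE; ring.
have M_P x : min_dist_set U W x <-> U x /\ A x = b.
  rewrite min_dist_setP//; split=> -[Ux Ax]; split=> //.
    by rewrite AU.
  by rewrite -[LHS]AU.
split=> [[m /M_P[Um Am]]|M0].
  have L_lin := linear_subspaceI U_lin V_lin.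
  have L_closed : rclosed (U `&` V).
    move=> x hx; split.
      by apply: U_closed => e /hx[y [Uy _] xy]; exists y.
    by apply: V_closed => e /hx[y [_ Vy] xy]; exists y.
  have L_P x : U x -> A x = 0 -> (U `&` V) x.
    move=> Ux Ax; split=> //; apply/(coproj_eq0 V_lin V_closed).
    by rewrite -(PU_id x Ux); exact: (proj_coproj_ker U_lin).
  (* [U] meets the kernel of [A] in [U] intersected with [V], so [M] is the translate of this
     intersection by [m] and [p] is the projection of [u 0] onto it. *)
  pose c := orth_proj (U `&` V) (u 0%N - m); pose p := m + c.
  have [[Uc Vc] c_orth] := orth_projP L_lin L_closed (u 0%N - m).
  have Up : U p by have [_ UD _] := U_sub; exact: UD.
  have Ap : A p = b.
    rewrite /p (selfadjD A_adj) Am AU//.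
    have -> : Q c = 0 by apply/(coproj_eq0 V_lin V_closed).
    by rewrite (selfadj0 PU_adj) addr0.
  have -> : orth_proj (min_dist_set U W) (u 0%N) = p.
    apply: orth_proj_unique; first exact/M_P.
    move=> q /M_P[Uq Aq].
    have -> : u 0%N - p = u 0%N - m - c by rewrite opprD addrA.
    apply: c_orth.
    apply: L_P; first exact: (rsubspaceB U_sub).
    by rewrite (selfadjB A_adj) Aq Ap subrr.
  have v_relax : relaxation A alpha (fun n => u n - p).
    move=> n; rewrite u_rec (selfadjB A_adj) Ap.
    by apply: rinner_inj => z; rewrite !rinnerE; ring.
  apply: cvg_rnorm => e e0.
  have [|N hN] := relaxation_cvg0 A_adj A_le s_gt0 lambda01 div v_relax _ e0.
    (* A kernel vector [y] may lie outside [U]; since [u 0 - p] is in [U], it can be replaced by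
       [PU y], which lies in both [U] and [V]. *)
    move=> y Ay; rewrite -[u 0%N - p]PU_id; last exact: (rsubspaceB U_sub).
    rewrite PU_adj /p opprD addrA /rinner c_orth ?re_scalar0//.
    have UPUy : U (PU y) by exact: orth_proj_in.
    by apply: L_P => //; rewrite AU.
  by exists N => // n /hN; rewrite -rnormN opprB.
apply/cvgryPge => r; apply: contrapT => not_large.
suff [x Ux Ax] : exists2 x, U x & A x = b.
  by have : min_dist_set U W x by [exact/M_P]; rewrite M0.
apply: (@bounded_approx_solution _ _ _ _ _ _ U_sub U_closed A_adj _ r).
  exact: proj_coproj_rnorm.
move=> e e0.
have r_relax : relaxation A alpha (fun n => A (u n) - b).
  move=> n; rewrite u_rec (selfadjB A_adj) (selfadjZ A_adj).
  by apply: rinner_inj => z; rewrite !rinnerE; ring.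
have [|N hN] := relaxation_cvg0 A_adj A_le s_gt0 lambda01 div r_relax _ e0.
  (* The initial residual is orthogonal to the kernel: [<b, y> = <w, Q P y>], and [Q P y = 0]
     whenever [A y = 0]. *)
  move=> y Ay; rewrite rinnerBl A_adj Ay rinnerC rinner0l /b PU_adj Q_adj.
  have -> : Q (PU y) = 0 by exact: (proj_coproj_ker U_lin).
  by rewrite rinnerC rinner0l subrr.
(* Norms below [r] recur beyond [N], where the residual is already below [e]. *)
apply: contrapT => none; apply: not_large; exists N => // n /= Nn.
rewrite leNgt; apply/negP => un_r; apply: none.
by exists (u n); [split=> //; exact: ltW (hN _ Nn)|exact: ltW].
Qed.
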